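(* Let $E,F$ be Banach spaces and suppose that for $i=1,2$ the operator $\mathcal{A}_i$ generates on $\mathcal{E}=E\times F$ the strongly continuous semigroup $(\mathcal{T}_i(t))_{t\ge0}$ of upper triangular form $$\mathcal{T}_i(t)=\begin{pmatrix}T_i(t)&R_i(t)\\0&S_i(t)\end{pmatrix}.$$ If there exist $M'\ge1$, $K>0$ and $\omega'\in\mathbb{R}$ such that for all $i=1,2$, $t\ge0$ and $n\in\mathbb{N}$ (i) $\|\frac1{2^n}(T_1(\frac tn)T_2(\frac tn)+T_2(\frac tn)T_1(\frac tn))^n\|\le M'\mathrm{e}^{\omega't}$ and $\|\frac1{2^n}(S_1(\frac tn)S_2(\frac tn)+S_2(\frac tn)S_1(\frac tn))^n\|\le M'\mathrm{e}^{\omega't}$, (ii) $\|R_i(t)\|\le Kt\cdot\mathrm{e}^{\omega't}$, then there are $M\ge1$ and $\omega\in\mathbb{R}$ such that $$\Bigl\|\frac1{2^n}\bigl(\mathcal{T}_1(\tfrac tn)\mathcal{T}_2(\tfrac tn)+\mathcal{T}_2(\tfrac tn)\mathcal{T}_1(\tfrac tn)\bigr)^n\Bigr\|\le M\mathrm{e}^{\omega t}\quad\text{for all }t\ge0\text{ and }n\in\mathbb{N}.$$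
   Context: Operators on $E\times F$ are written as $2\times2$ matrices acting on columns; here $T_i(t)\in\mathcal{L}(E)$, $R_i(t)\in\mathcal{L}(F,E)$, $S_i(t)\in\mathcal{L}(F)$. $\mathbb{N}=\{1,2,\dots\}$. The norm on $\mathcal{E}$ is any of the usual (equivalent) product norms. *)

(* Defs.v *)
From Stdlib Require Import Reals.
From Coquelicot Require Import Coquelicot.

Set Implicit Arguments.
Unset Strict Implicit.
Unset Printing Implicit Defensive.

Open Scope R_scope.

(* Banach spaces are taken over either R or C; the norm is real-valued in both
   cases. *)
Inductive scalars : Set := RealScalars | ComplexScalars.

Definition scalar_ring (s : scalars) : AbsRing :=
  match s with
  | RealScalars => R_AbsRing
  | ComplexScalars => C_AbsRing
  end.

Definition of_real (s : scalars) : R -> scalar_ring s :=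
  match s return R -> scalar_ring s with
  | RealScalars => fun r => r
  | ComplexScalars => fun r => RtoC r
  end.

Section Operators.

Variable s : scalars.

Definition op_plus (U V : NormedModule (scalar_ring s)) (A B : U -> V) : U -> V :=
  fun x => plus (A x) (B x).

Definition op_scal (U V : NormedModule (scalar_ring s)) (r : R) (A : U -> V) :
  U -> V := fun x => scal (of_real s r) (A x).

Definition op_mult (U V W : NormedModule (scalar_ring s))
  (A : V -> W) (B : U -> V) : U -> W := fun x => A (B x).

Definition op_zero (U V : NormedModule (scalar_ring s)) : U -> V := fun _ => zero.

Definition op_pow (U : NormedModule (scalar_ring s)) (A : U -> U) (n : nat) :
  U -> U := fun x => Nat.iter n A x.

(* [p_infty] when [A] is unbounded. *)
Definition op_norm (U V : NormedModule (scalar_ring s)) (A : U -> V) : Rbar :=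
  Lub_Rbar (fun r => exists x : U, norm x <= 1 /\ r = norm (A x)).

Definition op_matrix (E F : NormedModule (scalar_ring s))
  (A : E -> E) (B : F -> E) (C : E -> F) (D : F -> F) :
  prod_NormedModule (scalar_ring s) E F -> prod_NormedModule (scalar_ring s) E F :=
  fun p => (plus (A (fst p)) (B (snd p)), plus (C (fst p)) (D (snd p))).

Record C0_semigroup (X : NormedModule (scalar_ring s)) (T : R -> X -> X) : Prop := {
  C0_bounded : forall t, 0 <= t -> is_linear (T t);
  C0_id : forall x, T 0 x = x;
  C0_add : forall t u, 0 <= t -> 0 <= u -> forall x, T (t + u) x = T t (T u x);
  C0_continuous : forall x t, 0 <= t ->
    filterlim (fun u => T u x) (within (fun u => 0 <= u) (locally t))
              (locally (T t x))
}.

Record unbounded_operator (X : NormedModule (scalar_ring s)) : Type := {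
  dom : X -> Prop;
  app : {x : X | dom x} -> X
}.

Definition is_right_derivative_0 (X : NormedModule (scalar_ring s))
  (T : R -> X -> X) (x y : X) : Prop :=
  filterlim (fun h => scal (of_real s (/ h)) (minus (T h x) x))
            (at_right 0) (locally y).

Definition generates (X : NormedModule (scalar_ring s))
  (A : unbounded_operator X) (T : R -> X -> X) : Prop :=
  C0_semigroup T /\
  (forall x, dom A x <-> exists y, is_right_derivative_0 T x y) /\
  (forall x : {x : X | dom A x}, is_right_derivative_0 T (proj1_sig x) (app x)).

Definition sym_prod_pow (U : NormedModule (scalar_ring s)) (A B : U -> U) (n : nat) :
  U -> U :=
  op_scal (1 / 2 ^ n) (op_pow (op_plus (op_mult A B) (op_mult B A)) n).

End Operators.

Arguments op_zero {s} U V _.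

(* Main.v *)
Require Import Defs.
From Stdlib Require Import Reals Lra Lia Classical IndefiniteDescription.
From Coquelicot Require Import Coquelicot.
Open Scope R_scope.

(** Write h = t/n and split the symmetrized product
    G = TT1(h) TT2(h) + TT2(h) TT1(h) into blocks.  It is again upper triangular:
    its diagonal blocks A, D are the symmetrized products of the T_i(h) and of the
    S_i(h), and its corner is B = T1 R2 + R1 S2 + T2 R1 + R2 S1, all at h.  Hence
    the corner of G^n is the sum over k < n of A^(n-1-k) B D^k.

    With rho = 2 exp(omega' h), the stability hypotheses at time k h say that the k-th
    powers of A and D are bounded by M' rho^k ([stable_powers]).  Each of the n
    summands is therefore at most M'^2 |B| rho^(n-1).  Every term of B has a factor
    R_i(h), of size at most K h exp(omega' h), so |B| / rho is O(h)
    provided the other factor T_i(h) or S_i(h) grows at most exponentially.  Since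
    n h = t, the n summands add up to a constant times t times an exponential, and
    t <= exp t absorbs the remaining t.  This is [triangular_sym_prod_stable].

    The exponential growth of T_i and S_i does not follow from stability, which
    controls only symmetrized products.  It comes from the C0 property: the diagonal blocks
    of a triangular C0 semigroup are C0 semigroups on E and on F, and a C0
    semigroup on a Banach space is exponentially bounded by uniform boundedness
    near 0.  Uniform boundedness is obtained by a gliding hump: for bounded
    operators T_k and vectors u_k of the unit ball, a geometric choice of perturbations
    produces one vector x on which every T_k has size at least
    4^(-k)/3 |T_k u_k| ([gliding_hump]). *)

(** * Norms and operator bounds *)

(** Normed modules only require |l x| <= |l| |x|; equality for real l comes from
    applying that inequality to 1/l as well. *)
Lemma norm_scal_of_real (s : scalars) (V : NormedModule (scalar_ring s))
  (r : R) (x : V) : norm (scal (of_real s r) x) = Rabs r * norm x.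
Proof.
  assert (Habs : forall r, abs (of_real s r) = Rabs r).
  { intros a; destruct s; [reflexivity | exact (Cmod_R a)]. }
  assert (Hle : forall a (y : V), norm (scal (of_real s a) y) <= Rabs a * norm y).
  { intros a y; rewrite <- Habs; apply norm_scal. }
  apply Rle_antisym; [apply Hle|].
  destruct (Req_dec r 0) as [-> | Hr].
  { rewrite Rabs_R0, Rmult_0_l; apply norm_ge_0. }
  assert (Hx : x = scal (of_real s (/ r)) (scal (of_real s r) x)).
  { rewrite scal_assoc.
    replace (mult (of_real s (/ r)) (of_real s r)) with (@one (scalar_ring s)).
    { now rewrite scal_one. }
    destruct s; cbn.
    - unfold mult, one; cbn; now field.
    - unfold mult, one; cbn. rewrite <- RtoC_mult. now rewrite Rinv_l. }
  pose proof (Hle (/ r) (scal (of_real s r) x)) as H.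
  rewrite <- Hx, Rabs_inv in H.
  pose proof (Rabs_pos_lt r Hr).
  apply Rmult_le_compat_l with (r := Rabs r) in H; [|lra].
  rewrite <- Rmult_assoc, Rinv_r, Rmult_1_l in H; lra.
Qed.

Lemma minus_plus_cancel (G : AbelianGroup) (x w : G) : minus (plus x w) x = w.
Proof.
  unfold minus; rewrite (plus_comm x w), <- plus_assoc.
  apply eq_trans with (2 := plus_zero_r w), f_equal, plus_opp_r.
Qed.

(** A single head symbol for the distance: over a complete space, the subtraction
    under the norm can be elaborated along several structure paths, which linear
    arithmetic would treat as distinct atoms. *)
Definition ndist {K : AbsRing} {V : NormedModule K} (x y : V) : R :=
  norm (minus x y).

Lemma ndist_sym (K : AbsRing) (V : NormedModule K) (x y : V) :
  ndist x y = ndist y x.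
Proof. unfold ndist; rewrite <- opp_minus; apply norm_opp. Qed.

Lemma ndist_diag (K : AbsRing) (V : NormedModule K) (x : V) : ndist x x = 0.
Proof.
  apply eq_trans with (norm (@zero V)); [|apply norm_zero].
  apply (f_equal norm); exact (@minus_eq_zero V x).
Qed.

Lemma ndist_triangle (K : AbsRing) (V : NormedModule K) (x y z : V) :
  ndist x z <= ndist x y + ndist y z.
Proof. unfold ndist; rewrite (minus_trans y x z); apply norm_triangle. Qed.

Lemma norm_le_ndist (K : AbsRing) (V : NormedModule K) (x y : V) :
  norm x <= norm y + ndist x y.
Proof.
  pose proof (norm_triangle_inv x y) as H.
  pose proof (Rle_abs (norm x - norm y)); unfold ndist; lra.
Qed.

Lemma op_norm_le_unit (s : scalars) (U V : NormedModule (scalar_ring s))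
  (A : U -> V) (c : R) :
  Rbar_le (op_norm A) c <-> forall x, norm x <= 1 -> norm (A x) <= c.
Proof.
  unfold op_norm; split.
  - intros H x Hx.
    destruct (Lub_Rbar_correct (fun r => exists x, norm x <= 1 /\ r = norm (A x)))
      as [Hub _].
    exact (Rbar_le_trans (norm (A x)) _ c (Hub _ (ex_intro _ x (conj Hx eq_refl))) H).
  - intros H; apply Lub_Rbar_correct.
    intros r [x [Hx ->]]; now apply H.
Qed.

Lemma unit_bound_norm (s : scalars) (U V : NormedModule (scalar_ring s))
  (A : U -> V) (c : R) :
  is_linear A -> (forall x, norm x <= 1 -> norm (A x) <= c) ->
  forall x, norm (A x) <= c * norm x.
Proof.
  intros HA H x.
  destruct (Req_dec (norm x) 0) as [H0 | H0].
  { rewrite (norm_eq_zero x H0), (linear_zero A HA), !norm_zero; lra. }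
  assert (Hx : 0 < norm x) by (pose proof (norm_ge_0 x); lra).
  pose proof (Rinv_0_lt_compat _ Hx).
  specialize (H (scal (of_real s (/ norm x)) x)).
  rewrite (linear_scal A HA), !norm_scal_of_real, (Rabs_pos_eq (/ norm x)) in H by lra.
  rewrite Rinv_l in H by lra.
  specialize (H (Rle_refl 1)).
  apply Rmult_le_compat_l with (r := norm x) in H; [|lra].
  rewrite <- Rmult_assoc, Rinv_r, Rmult_1_l in H; lra.
Qed.

Lemma is_linear_op_plus (s : scalars) (U V : NormedModule (scalar_ring s))
  (A B : U -> V) : is_linear A -> is_linear B -> is_linear (op_plus A B).
Proof.
  intros HA HB.
  apply (is_linear_comp (fun x => (A x, B x)) (fun p => plus (fst p) (snd p))).
  - now apply is_linear_prod.
  - apply is_linear_plus.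
Qed.

Lemma is_linear_op_pow (s : scalars) (U : NormedModule (scalar_ring s))
  (A : U -> U) (n : nat) : is_linear A -> is_linear (op_pow A n).
Proof.
  intros HA; induction n as [|n IH].
  - apply is_linear_id.
  - exact (is_linear_comp (op_pow A n) A IH HA).
Qed.

(** * Uniform boundedness by a gliding hump *)

(** N is the operator norm of T; it need not be attained, and two thirds of it is
    the fraction that the next lemma can afford. *)
Lemma near_norming (s : scalars) (U V : NormedModule (scalar_ring s))
  (T : U -> V) (u : U) :
  is_linear T -> norm u <= 1 ->
  exists (N : R) (v : U), norm v <= 1 /\ norm (T u) <= N /\
    2 / 3 * N <= norm (T v) /\ forall z, norm (T z) <= N * norm z.
Proof.
  intros HT Hu.
  destruct (linear_norm T HT) as [M [HM HMT]].
  assert (Hub : Rbar_le (op_norm T) M).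
  { apply op_norm_le_unit; intros x Hx.
    apply Rle_trans with (1 := HMT x). rewrite <- (Rmult_1_r M) at 2.
    apply Rmult_le_compat_l; lra. }
  assert (Hlb : Rbar_le (norm (T u)) (op_norm T)).
  { apply Lub_Rbar_correct; now exists u. }
  destruct (op_norm T) as [N | |] eqn:HN; try easy.
  simpl in Hlb.
  assert (HTN : forall x, norm x <= 1 -> norm (T x) <= N).
  { apply op_norm_le_unit; rewrite HN; apply Rle_refl. }
  destruct (classic (exists v, norm v <= 1 /\ 2 / 3 * N <= norm (T v)))
    as [[v [Hv HTv]] | Hno].
  - exists N, v; repeat split; trivial. now apply unit_bound_norm.
  - assert (H : Rbar_le (op_norm T) (2 / 3 * N)).
    { apply op_norm_le_unit; intros x Hx; apply Rnot_lt_le; intros Hlt.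
      apply Hno; exists x; split; [trivial | now apply Rlt_le]. }
    rewrite HN in H; simpl in H.
    pose proof (norm_ge_0 (T u)).
    exfalso; apply Hno; exists u; split; lra.
Qed.

(** The largeness of T at u can be moved within distance r of any x, and survives
    further moves of size r/3: with v nearly norming, 2 T(r v) is the difference of
    T(x + r v) and T(x - r v), so one of these is at least r |T v| >= (2/3) r N,
    and a move of size r/3 costs at most (1/3) r N. *)
Lemma exists_robust_peak (s : scalars) (U V : NormedModule (scalar_ring s))
  (T : U -> V) (u x : U) (r : R) :
  is_linear T -> norm u <= 1 -> 0 <= r ->
  exists y, ndist y x <= r /\
    forall z, ndist z y <= r / 3 -> r / 3 * norm (T u) <= norm (T z).
Proof.
  intros HT Hu Hr.
  destruct (near_norming s U V T u HT Hu) as (N & v & Hv & HuN & HvN & HN).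
  set (w := scal (of_real s r) v).
  assert (Hw : norm w <= r).
  { unfold w; rewrite norm_scal_of_real, Rabs_pos_eq by trivial.
    rewrite <- (Rmult_1_r r) at 2; now apply Rmult_le_compat_l. }
  assert (HTw : norm (T w) = r * norm (T v)).
  { unfold w; now rewrite (linear_scal T HT), norm_scal_of_real, Rabs_pos_eq. }
  assert (Hsum : 2 * norm (T w) <= norm (T (plus x w)) + norm (T (minus x w))).
  { replace (2 * norm (T w)) with (norm (minus (T (plus x w)) (T (minus x w)))).
    { apply Rle_trans with (1 := norm_triangle _ _). rewrite norm_opp; lra. }
    rewrite <- (linear_minus T _ _ HT).
    replace (minus (plus x w) (minus x w)) with (scal (of_real s 2) w).
    { rewrite (linear_scal T HT), norm_scal_of_real, Rabs_pos_eq; lra. }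
    replace (of_real s 2) with (plus (@one (scalar_ring s)) one).
    { rewrite scal_distr_r, scal_one.
      unfold minus at 1; rewrite opp_minus; unfold minus.
      rewrite (plus_comm x w), <- plus_assoc; f_equal.
      now rewrite plus_comm, <- plus_assoc, plus_opp_l, plus_zero_r. }
    destruct s; unfold plus, one; cbn; [lra|].
    rewrite <- RtoC_plus; f_equal; lra. }
  assert (Hy : exists y : U, ndist y x <= r /\ r * norm (T v) <= norm (T y)).
  { destruct (Rle_dec (norm (T w)) (norm (T (plus x w)))) as [H | H].
    - exists (plus x w); split; [|lra].
      now unfold ndist; rewrite minus_plus_cancel.
    - exists (minus x w); split; [|lra].
      unfold ndist; unfold minus at 2; now rewrite minus_plus_cancel, norm_opp. }
  destruct Hy as [y [Hyx HTy]]; exists y; split; [trivial|].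
  intros z Hz.
  assert (H1 : norm (T y) <= norm (T z) + N * (r / 3)).
  { apply Rle_trans with (1 := norm_le_ndist _ _ _ (T z)).
    apply Rplus_le_compat_l; unfold ndist; rewrite <- (linear_minus T _ _ HT).
    apply Rle_trans with (1 := HN _).
    fold (ndist y z); rewrite ndist_sym; apply Rmult_le_compat_l; trivial.
    apply Rle_trans with (2 := HuN), norm_ge_0. }
  assert (r * (2 / 3 * N) <= r * norm (T v)) by now apply Rmult_le_compat_l.
  assert (r * norm (T u) <= r * N) by now apply Rmult_le_compat_l.
  lra.
Qed.

(** The ratio 1/4 makes the tail beyond step k+1 sum to a third of the k-th step,
    which is the margin left by [exists_robust_peak]. *)
Lemma geometric_steps_converge (K : AbsRing) (X : CompleteNormedModule K)
  (x : nat -> X) :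
  (forall k, ndist (x (S k)) (x k) <= (1 / 4) ^ k) ->
  exists l, forall k, ndist l (x k) <= 4 / 3 * (1 / 4) ^ k.
Proof.
  intros Hx.
  assert (Htail : forall k m, ndist (x (m + k)%nat) (x k)
            <= 4 / 3 * ((1 / 4) ^ k - (1 / 4) ^ (m + k))).
  { intros k m; induction m as [|m IH]; cbn [Nat.add].
    - rewrite ndist_diag; lra.
    - apply Rle_trans with (1 := ndist_triangle _ _ _ (x (m + k)%nat) _).
      pose proof (Hx (m + k)%nat); cbn [pow]; lra. }
  assert (Htail' : forall k m, ndist (x (m + k)%nat) (x k) <= 4 / 3 * (1 / 4) ^ k).
  { intros k m; apply Rle_trans with (1 := Htail k m).
    pose proof (pow_lt (1 / 4) (m + k) ltac:(lra)); lra. }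
  assert (Hlim : exists l, filterlim x eventually (locally l)).
  { apply (filterlim_locally_cauchy (F := eventually) (U := X) x); intros eps.
    destruct (pow_lt_1_zero (1 / 4)) with (y := eps / 4) as [k Hk].
    { rewrite Rabs_pos_eq; lra. }
    { pose proof (cond_pos eps); lra. }
    specialize (Hk k (le_n k)).
    rewrite Rabs_pos_eq in Hk by (apply pow_le; lra).
    exists (fun m => (k <= m)%nat); split; [now exists k|].
    intros a b Ha Hb; apply (norm_compat1 (x a : X) (x b) eps).
    change (ndist (x b) (x a) < eps).
    apply Rle_lt_trans with (1 := ndist_triangle _ _ _ (x k) _).
    pose proof (Htail' k (a - k)%nat) as Ha'.
    pose proof (Htail' k (b - k)%nat) as Hb'.
    rewrite Nat.sub_add in Ha', Hb' by trivial.
    rewrite (ndist_sym _ _ (x k)). pose proof (cond_pos eps); lra. }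
  destruct Hlim as [l Hl]; exists l; intros k.
  apply le_epsilon; intros eps Heps.
  destruct (proj1 (filterlim_locally_ball_norm x l) Hl (mkposreal eps Heps)) as [m Hm].
  specialize (Hm (m + k)%nat (Nat.le_add_r m k)); change (ndist (x (m + k)%nat) l < eps) in Hm.
  apply Rle_trans with (1 := ndist_triangle _ _ _ (x (m + k)%nat) _).
  rewrite (ndist_sym _ _ l). pose proof (Htail' k m); lra.
Qed.

(** Quantitative uniform boundedness: if the |T_k u_k| outgrow 4^k, then the orbit
    of the single vector x is unbounded.  Step k secures T_k by a move of size
    4^(-k), and the later moves together are too small to undo it. *)
Lemma gliding_hump (s : scalars) (X : CompleteNormedModule (scalar_ring s))
  (V : NormedModule (scalar_ring s)) (T : nat -> X -> V) (u : nat -> X) :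
  (forall k, is_linear (T k)) -> (forall k, norm (u k) <= 1) ->
  exists x, forall k, (1 / 4) ^ k / 3 * norm (T k (u k)) <= norm (T k x).
Proof.
  intros HT Hu.
  assert (Hstep : forall kx : nat * X, exists y,
      ndist y (snd kx) <= (1 / 4) ^ fst kx /\
      forall z, ndist z y <= (1 / 4) ^ fst kx / 3 ->
        (1 / 4) ^ fst kx / 3 * norm (T (fst kx) (u (fst kx))) <= norm (T (fst kx) z)).
  { intros [k x]; apply exists_robust_peak; trivial; apply pow_le; lra. }
  apply functional_choice in Hstep; destruct Hstep as [f Hf].
  set (x := nat_rect (fun _ => X : Type) zero (fun k y => f (k, y))).
  destruct (geometric_steps_converge _ X x) as [l Hl].
  { intros k; apply (Hf (k, x k)). }
  exists l; intros k.
  apply (proj2 (Hf (k, x k))); simpl.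
  pose proof (Hl (S k)) as H; simpl in H; fold (x k) in H. lra.
Qed.

(** * Exponential growth of C0 semigroups *)

(** Otherwise there are times t_k -> 0 and u_k in the unit ball with
    |T(t_k) u_k| > (k+1) 4^k, and the gliding hump gives x with |T(t_k) x| -> oo,
    against the continuity of the orbit of x at time 0. *)
Lemma C0_semigroup_locally_bounded (s : scalars)
  (X : CompleteNormedModule (scalar_ring s)) (T : R -> X -> X) :
  C0_semigroup T ->
  exists delta C, 0 < delta /\ 1 <= C /\
    forall t, 0 <= t <= delta -> forall x, norm (T t x) <= C * norm x.
Proof.
  intros HT; apply NNPP; intros Hno.
  assert (Hbad : forall k : nat, exists tu : R * X,
      0 <= fst tu <= / INR (S k) /\ norm (snd tu) <= 1 /\
      INR (S k) * 4 ^ k < norm (T (fst tu) (snd tu))).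
  { intros k; apply NNPP; intros Hk; apply Hno.
    pose proof (lt_0_INR (S k) (Nat.lt_0_succ k)) as Hpos.
    exists (/ INR (S k)), (INR (S k) * 4 ^ k); split; [now apply Rinv_0_lt_compat|].
    split.
    { rewrite <- (Rmult_1_l 1). apply Rmult_le_compat; try lra.
      - rewrite S_INR; pose proof (pos_INR k); lra.
      - apply pow_R1_Rle; lra. }
    intros t Ht; apply unit_bound_norm; [now apply (C0_bounded HT)|].
    intros x Hx; apply Rnot_lt_le; intros Hlt; apply Hk.
    now exists (t, x). }
  apply functional_choice in Hbad; destruct Hbad as [tu Htu].
  destruct (gliding_hump s X X (fun k => T (fst (tu k))) (fun k => snd (tu k)))
    as [x Hx].
  { intros k; apply (C0_bounded HT), Htu. }
  { intros k; apply Htu. }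
  assert (Hlarge : forall k, INR (S k) / 3 <= norm (T (fst (tu k)) x)).
  { intros k; apply Rle_trans with (2 := Hx k).
    destruct (Htu k) as (_ & _ & H).
    replace (INR (S k) / 3) with ((1 / 4) ^ k / 3 * (INR (S k) * 4 ^ k)).
    - apply Rmult_le_compat_l; [|lra].
      pose proof (pow_lt (1 / 4) k ltac:(lra)); lra.
    - unfold Rdiv at 2; rewrite Rmult_1_l, pow_inv. field. apply pow_nonzero; lra. }
  pose proof (C0_continuous HT (x := x) (Rle_refl 0)) as Hc.
  rewrite (C0_id HT) in Hc.
  apply (filterlim_locally_ball_norm (fun t => T t x) x) with (eps := mkposreal 1 Rlt_0_1)
    in Hc.
  destruct Hc as [d Hd].
  (* k is so large that t_k < d and that |T(t_k) x| exceeds |x| + 1. *)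
  destruct (nfloor_ex (Rmax (/ d) (3 * (norm x + 1)))) as [k [_ Hk]].
  { apply Rle_trans with (2 := Rmax_l _ _), Rlt_le, Rinv_0_lt_compat, cond_pos. }
  rewrite <- S_INR in Hk.
  pose proof (Rmax_l (/ d) (3 * (norm x + 1))).
  pose proof (Rmax_r (/ d) (3 * (norm x + 1))).
  destruct (Htu k) as ([Ht0 Ht1] & _ & _).
  assert (Hball : ball 0 d (fst (tu k))).
  { apply (norm_compat1 0 (fst (tu k)) d).
    unfold norm, minus, plus, opp; simpl; unfold abs; simpl.
    rewrite Ropp_0, Rplus_0_r, Rabs_pos_eq by trivial.
    apply Rle_lt_trans with (1 := Ht1).
    rewrite <- (Rinv_inv d). apply Rinv_lt_contravar; [|lra].
    apply Rmult_lt_0_compat; [apply Rinv_0_lt_compat, cond_pos | ].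
    apply lt_0_INR; lia. }
  specialize (Hd _ Hball Ht0); change (ndist (T (fst (tu k)) x) x < 1) in Hd.
  pose proof (norm_le_ndist _ _ (T (fst (tu k)) x) x).
  pose proof (Hlarge k); lra.
Qed.

Lemma exp_nondecreasing (x y : R) : x <= y -> exp x <= exp y.
Proof.
  intros [H | ->]; [now apply Rlt_le, exp_increasing | apply Rle_refl].
Qed.

(** With w = ln C / d, each step of length d multiplies the bound by
    C = exp (w d); the initial remainder in [0, d] costs the leading factor C. *)
Lemma C0_semigroup_exp_bounded (s : scalars)
  (X : CompleteNormedModule (scalar_ring s)) (T : R -> X -> X) :
  C0_semigroup T ->
  exists C w, 1 <= C /\ 0 <= w /\
    forall t, 0 <= t -> forall x, norm (T t x) <= C * exp (w * t) * norm x.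
Proof.
  intros HT.
  destruct (C0_semigroup_locally_bounded s X T HT) as (d & C & Hd & HC & Hloc).
  assert (Hw : 0 <= ln C / d).
  { apply Rdiv_le_0_compat; trivial. rewrite <- ln_1; apply ln_le; lra. }
  exists C, (ln C / d); split; [trivial|]; split; [trivial|].
  assert (Hn : forall (n : nat) t, 0 <= t <= INR (S n) * d ->
            forall x, norm (T t x) <= C * exp (ln C / d * t) * norm x).
  { induction n as [|n IH]; intros t Ht x.
    - simpl in Ht; rewrite Rmult_1_l in Ht.
      apply Rle_trans with (1 := Hloc t Ht x), Rmult_le_compat_r; [apply norm_ge_0|].
      rewrite <- (Rmult_1_r C) at 1; apply Rmult_le_compat_l; [lra|].
      rewrite <- exp_0; apply exp_nondecreasing, Rmult_le_pos; lra.
    - destruct (Rle_dec t d) as [Htd | Htd].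
      + apply IH; split; [lra|]. apply Rle_trans with (1 := Htd).
        rewrite <- (Rmult_1_l d) at 1; apply Rmult_le_compat_r; [lra|].
        rewrite S_INR; pose proof (pos_INR n); lra.
      + replace (T t x) with (T d (T (t - d) x)).
        2: { rewrite <- (C0_add HT); [f_equal|..]; lra. }
        apply Rle_trans with (1 := Hloc d (conj (Rlt_le _ _ Hd) (Rle_refl d)) _).
        replace (exp (ln C / d * t)) with (C * exp (ln C / d * (t - d))).
        2: { rewrite <- (exp_ln C) at 1 by lra. rewrite <- exp_plus; f_equal; field; lra. }
        rewrite !Rmult_assoc; apply Rmult_le_compat_l; [lra|].
        rewrite <- Rmult_assoc; apply IH.
        rewrite S_INR in Ht; lra. }
  intros t Ht x.
  destruct (nfloor_ex (t / d)) as [n [_ Hnt]]; [apply Rdiv_le_0_compat; lra|].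
  apply (Hn n); split; [trivial|].
  apply Rlt_le; rewrite S_INR.
  apply Rmult_lt_compat_r with (r := d) in Hnt; [|trivial].
  unfold Rdiv in Hnt; rewrite Rmult_assoc, Rinv_l, Rmult_1_r in Hnt; lra.
Qed.

(** E embeds as an invariant subspace, on which TT acts by T, and F is the
    quotient by it, on which TT acts by S; the C0 properties pass to both. *)
Lemma diagonal_blocks_C0_semigroup (s : scalars) (E F : NormedModule (scalar_ring s))
  (TT : R -> prod_NormedModule (scalar_ring s) E F ->
             prod_NormedModule (scalar_ring s) E F)
  (T : R -> E -> E) (Q : R -> F -> E) (S : R -> F -> F) :
  C0_semigroup TT ->
  (forall t, 0 <= t -> is_linear (T t)) ->
  (forall t, 0 <= t -> is_linear (Q t)) ->
  (forall t, 0 <= t -> is_linear (S t)) ->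
  (forall t, 0 <= t -> forall p,
     TT t p = op_matrix (T t) (Q t) (op_zero E F) (S t) p) ->
  C0_semigroup T /\ C0_semigroup S.
Proof.
  intros HTT HT HQ HS Htri.
  assert (HE : forall t, 0 <= t -> forall x, TT t (x, zero) = (T t x, zero)).
  { intros t Ht x; rewrite Htri by trivial; unfold op_matrix, op_zero; simpl.
    now rewrite (linear_zero _ (HQ t Ht)), (linear_zero _ (HS t Ht)), !plus_zero_r. }
  assert (HF : forall t, 0 <= t -> forall p, snd (TT t p) = S t (snd p)).
  { intros t Ht p; rewrite Htri by trivial; apply plus_zero_l. }
  split; split; trivial.
  - intros x; pose proof (HE 0 (Rle_refl 0) x) as H.
    rewrite (C0_id HTT) in H; now injection H.
  - intros t u Ht Hu x; pose proof (HE (t + u) (Rplus_le_le_0_compat t u Ht Hu) x) as H.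
    rewrite (C0_add HTT), !HE in H by trivial; now injection H.
  - intros x t Ht; apply (filterlim_locally_ball_norm (fun u => T u x)); intros eps.
    pose proof (C0_continuous HTT (x := (x, zero)) Ht) as H.
    apply (filterlim_locally_ball_norm (fun u => TT u (x, zero))) with (eps := eps) in H.
    unfold within in *; revert H; apply filter_imp; intros u Hu Hu0.
    specialize (Hu Hu0); rewrite !HE in Hu by trivial.
    apply Rle_lt_trans with (2 := Hu).
    apply Rle_trans with (2 := proj1 (norm_prod _ _)), Rmax_l.
  - intros y; pose proof (HF 0 (Rle_refl 0) (zero, y)) as H.
    rewrite (C0_id HTT) in H; exact (eq_sym H).
  - intros t u Ht Hu y.
    pose proof (HF (t + u) (Rplus_le_le_0_compat t u Ht Hu) (zero, y)) as H.
    rewrite (C0_add HTT), !HF in H by trivial; exact (eq_sym H).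
  - intros y t Ht; apply (filterlim_locally_ball_norm (fun u => S u y)); intros eps.
    pose proof (C0_continuous HTT (x := (zero, y)) Ht) as H.
    apply (filterlim_locally_ball_norm (fun u => TT u (zero, y))) with (eps := eps) in H.
    unfold within in *; revert H; apply filter_imp; intros u Hu Hu0.
    specialize (Hu Hu0); apply Rle_lt_trans with (2 := Hu).
    change (S u y) with (S u (snd (@zero E, y))).
    change (S t y) with (S t (snd (@zero E, y))).
    rewrite <- !HF by trivial.
    apply Rle_trans with (2 := proj1 (norm_prod _ _)), Rmax_r.
Qed.

(** * Powers of triangular operators *)

Lemma exp_pow_INR (x : R) (n : nat) : exp x ^ n = exp (INR n * x).
Proof.
  induction n as [|n IH].
  - simpl; now rewrite Rmult_0_l, exp_0.
  - rewrite S_INR; cbn [pow]; rewrite IH, <- exp_plus; f_equal; ring.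
Qed.

(** The stability estimate for n steps up to time t is used with t = k h and n = k:
    the step stays h while the number of steps varies. *)
Lemma stable_powers (s : scalars) (U : NormedModule (scalar_ring s))
  (V W : R -> U -> U) (M w : R) :
  1 <= M ->
  (forall t, 0 <= t -> is_linear (V t) /\ is_linear (W t)) ->
  (forall t n, 0 <= t -> (1 <= n)%nat ->
     Rbar_le (op_norm (sym_prod_pow (V (t / INR n)) (W (t / INR n)) n))
             (M * exp (w * t))) ->
  forall h k x, 0 <= h ->
    norm (op_pow (op_plus (op_mult (V h) (W h)) (op_mult (W h) (V h))) k x)
    <= M * (2 * exp (w * h)) ^ k * norm x.
Proof.
  intros HM Hlin Hst h k x Hh.
  destruct (Hlin h Hh) as [HV HW].
  set (P := op_plus (op_mult (V h) (W h)) (op_mult (W h) (V h))).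
  assert (HP : is_linear (op_pow P k)).
  { apply is_linear_op_pow, is_linear_op_plus.
    - exact (is_linear_comp (W h) (V h) HW HV).
    - exact (is_linear_comp (V h) (W h) HV HW). }
  revert x; apply unit_bound_norm; [exact HP|].
  intros x Hx.
  destruct k as [|k]; [simpl; lra|].
  pose proof (Hst (INR (S k) * h) (S k)) as H.
  assert (Hk : 0 < INR (S k)) by (apply lt_0_INR; lia).
  replace (INR (S k) * h / INR (S k)) with h in H by (field; lra).
  specialize (H (Rmult_le_pos _ _ (Rlt_le _ _ Hk) Hh) (le_n_S 0 k (Nat.le_0_l k))).
  apply op_norm_le_unit with (x := x) in H; [|trivial].
  unfold sym_prod_pow, op_scal in H; fold P in H.
  assert (H2 : 0 < 2 ^ S k) by (apply pow_lt; lra).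
  rewrite norm_scal_of_real, Rabs_pos_eq in H.
  2: { apply Rlt_le, Rdiv_lt_0_compat; lra. }
  rewrite Rpow_mult_distr, exp_pow_INR.
  replace (INR (S k) * (w * h)) with (w * (INR (S k) * h)) by ring.
  replace (norm (op_pow P (S k) x))
    with (2 ^ S k * (1 / 2 ^ S k * norm (op_pow P (S k) x))) by (field; lra).
  replace (M * (2 ^ S k * exp (w * (INR (S k) * h))))
    with (2 ^ S k * (M * exp (w * (INR (S k) * h)))) by ring.
  apply Rmult_le_compat_l; lra.
Qed.

(** The corner of the k-th power is a sum of k products A^i B D^j with
    i + j = k - 1, each of norm at most M^2 b rho^(k-1). *)
Lemma upper_triangular_pow_bound (s : scalars) (E F : NormedModule (scalar_ring s))
  (G : prod_NormedModule (scalar_ring s) E F -> prod_NormedModule (scalar_ring s) E F)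
  (A : E -> E) (B : F -> E) (D : F -> F) (M b rho : R) :
  is_linear A ->
  (forall p, G p = (plus (A (fst p)) (B (snd p)), D (snd p))) ->
  0 <= M -> 0 <= b -> 0 < rho ->
  (forall k x, norm (op_pow A k x) <= M * rho ^ k * norm x) ->
  (forall k y, norm (op_pow D k y) <= M * rho ^ k * norm y) ->
  (forall y, norm (B y) <= b * norm y) ->
  forall k p,
    norm (fst (op_pow G k p))
      <= M * rho ^ k * norm (fst p)
         + INR k * (M ^ 2 * (b / rho)) * rho ^ k * norm (snd p)
    /\ norm (snd (op_pow G k p)) <= M * rho ^ k * norm (snd p).
Proof.
  intros HA HG HM Hb Hrho HAk HDk HB k p.
  assert (Hsnd : forall i, snd (op_pow G i p) = op_pow D i (snd p)).
  { induction i as [|i IH]; [reflexivity|].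
    change (op_pow G (S i) p) with (G (op_pow G i p)).
    rewrite HG; simpl snd; now rewrite IH. }
  split; [|rewrite Hsnd; apply HDk].
  (* Only powers of A are controlled: a bound for A itself would lose a factor at
     each step.  The induction on k therefore carries an arbitrary power A^j. *)
  assert (H : forall k j, norm (op_pow A j (fst (op_pow G k p)))
      <= M * rho ^ (j + k) * norm (fst p)
         + INR k * (M ^ 2 * (b / rho)) * rho ^ (j + k) * norm (snd p)).
  { clear k; induction k as [|k IH]; intros j.
    - rewrite Nat.add_0_r, !Rmult_0_l, Rplus_0_r; apply HAk.
    - change (op_pow G (S k) p) with (G (op_pow G k p)).
      rewrite HG; simpl fst.
      rewrite (linear_plus _ (is_linear_op_pow s E A j HA)).
      apply Rle_trans with (1 := norm_triangle _ _).
      replace (op_pow A j (A (fst (op_pow G k p))))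
        with (op_pow A (S j) (fst (op_pow G k p))) by apply Nat.iter_succ_r.
      pose proof (IH (S j)) as H1.
      assert (H2 : norm (op_pow A j (B (snd (op_pow G k p))))
                <= M * rho ^ j * (b * (M * rho ^ k * norm (snd p)))).
      { apply Rle_trans with (1 := HAk j _).
        apply Rmult_le_compat_l.
        { apply Rmult_le_pos; [trivial | apply pow_le; lra]. }
        apply Rle_trans with (1 := HB _), Rmult_le_compat_l; [trivial|].
        rewrite Hsnd; apply HDk. }
      replace (j + S k)%nat with (S j + k)%nat by lia.
      replace (M * rho ^ j * (b * (M * rho ^ k * norm (snd p))))
        with (M ^ 2 * (b / rho) * rho ^ (S j + k) * norm (snd p)) in H2.
      2: { cbn [Nat.add]. cbn [pow]. rewrite pow_add. field; lra. }
      rewrite S_INR; lra. }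
  exact (H k 0%nat).
Qed.

Lemma prod_norm_le_sum (K : AbsRing) (U V : NormedModule K) (x : U) (y : V) :
  norm (x, y) <= norm x + norm y.
Proof.
  change (sqrt (norm x ^ 2 + norm y ^ 2) <= norm x + norm y).
  pose proof (norm_ge_0 x); pose proof (norm_ge_0 y).
  rewrite <- (sqrt_pow2 (norm x + norm y)) by lra.
  apply sqrt_le_1_alt; pose proof (Rmult_le_pos _ _ H H0); simpl; lra.
Qed.

Lemma norm_le_comp (K : AbsRing) (U V W : NormedModule K)
  (P : V -> W) (Q : U -> V) (a c : R) (x : U) :
  0 <= a -> (forall v, norm (P v) <= a * norm v) ->
  (forall u, norm (Q u) <= c * norm u) -> norm (P (Q x)) <= a * c * norm x.
Proof.
  intros Ha HP HQ; apply Rle_trans with (1 := HP _).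
  rewrite Rmult_assoc; now apply Rmult_le_compat_l.
Qed.

(** * Symmetrized products of triangular operators *)

Definition corner {s : scalars} {E F : NormedModule (scalar_ring s)}
  (T1 T2 : E -> E) (R1 R2 : F -> E) (S1 S2 : F -> F) : F -> E :=
  op_plus (op_plus (op_mult T1 R2) (op_mult R1 S2))
          (op_plus (op_mult T2 R1) (op_mult R2 S1)).

Lemma plus_sum_regroup (G : AbelianMonoid) (a b c d e f : G) :
  plus (plus (plus a b) c) (plus (plus d e) f)
  = plus (plus a d) (plus (plus b c) (plus e f)).
Proof.
  rewrite <- !plus_assoc; f_equal.
  rewrite (plus_assoc b c), (plus_assoc (plus b c) d), (plus_comm (plus b c) d).
  now rewrite <- !plus_assoc.
Qed.

Lemma triangular_sym_prod (s : scalars) (E F : NormedModule (scalar_ring s))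
  (T1 T2 : E -> E) (R1 R2 : F -> E) (S1 S2 : F -> F)
  (p : prod_NormedModule (scalar_ring s) E F) :
  is_linear T1 -> is_linear T2 ->
  plus (op_matrix T1 R1 (op_zero E F) S1 (op_matrix T2 R2 (op_zero E F) S2 p))
       (op_matrix T2 R2 (op_zero E F) S2 (op_matrix T1 R1 (op_zero E F) S1 p))
  = (plus (op_plus (op_mult T1 T2) (op_mult T2 T1) (fst p))
          (corner T1 T2 R1 R2 S1 S2 (snd p)),
     op_plus (op_mult S1 S2) (op_mult S2 S1) (snd p)).
Proof.
  intros L1 L2; destruct p as [x y].
  unfold corner, op_plus, op_mult, op_matrix, op_zero; simpl.
  rewrite (linear_plus _ L1), (linear_plus _ L2), !plus_zero_l.
  apply (f_equal2 pair); [apply plus_sum_regroup | reflexivity].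
Qed.

Lemma corner_bound (s : scalars) (E F : NormedModule (scalar_ring s))
  (T1 T2 : E -> E) (R1 R2 : F -> E) (S1 S2 : F -> F) (c r : R) :
  0 <= c -> 0 <= r ->
  (forall x, norm (T1 x) <= c * norm x) -> (forall x, norm (T2 x) <= c * norm x) ->
  (forall y, norm (R1 y) <= r * norm y) -> (forall y, norm (R2 y) <= r * norm y) ->
  (forall y, norm (S1 y) <= c * norm y) -> (forall y, norm (S2 y) <= c * norm y) ->
  forall y, norm (corner T1 T2 R1 R2 S1 S2 y) <= 4 * (c * r) * norm y.
Proof.
  intros Hc Hr cT1 cT2 rR1 rR2 cS1 cS2 y; unfold corner, op_plus, op_mult.
  pose proof (norm_triangle (plus (T1 (R2 y)) (R1 (S2 y))) (plus (T2 (R1 y)) (R2 (S1 y)))).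
  pose proof (norm_triangle (T1 (R2 y)) (R1 (S2 y))).
  pose proof (norm_triangle (T2 (R1 y)) (R2 (S1 y))).
  pose proof (norm_le_comp _ _ _ _ T1 R2 c r y Hc cT1 rR2).
  pose proof (norm_le_comp _ _ _ _ T2 R1 c r y Hc cT2 rR1).
  pose proof (norm_le_comp _ _ _ _ R1 S2 r c y Hr rR1 cS2).
  pose proof (norm_le_comp _ _ _ _ R2 S1 r c y Hr rR2 cS1).
  lra.
Qed.

Lemma common_exp_bound (C w C' w' t : R) :
  0 <= C <= C' -> w <= w' -> 0 <= t -> C * exp (w * t) <= C' * exp (w' * t).
Proof.
  intros HC Hw Ht; apply Rmult_le_compat; try lra.
  - apply Rlt_le, exp_pos.
  - apply exp_nondecreasing, Rmult_le_compat_r; lra.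
Qed.

(** The combinatorial half of the theorem, with explicit constants: exponential
    growth of the diagonal blocks is taken as given.  The four terms of the
    corner, halved by the symmetrization, give the 2 in front of C. *)
Lemma triangular_sym_prod_stable
  (s : scalars) (E F : NormedModule (scalar_ring s))
  (TT1 TT2 : R -> prod_NormedModule (scalar_ring s) E F ->
                  prod_NormedModule (scalar_ring s) E F)
  (T1 T2 : R -> E -> E) (R1 R2 : R -> F -> E) (S1 S2 : R -> F -> F)
  (T_bounded : forall t, 0 <= t -> is_linear (T1 t) /\ is_linear (T2 t))
  (R_bounded : forall t, 0 <= t -> is_linear (R1 t) /\ is_linear (R2 t))
  (S_bounded : forall t, 0 <= t -> is_linear (S1 t) /\ is_linear (S2 t))
  (triangular1 : forall t, 0 <= t -> forall p,
     TT1 t p = op_matrix (T1 t) (R1 t) (op_zero E F) (S1 t) p)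
  (triangular2 : forall t, 0 <= t -> forall p,
     TT2 t p = op_matrix (T2 t) (R2 t) (op_zero E F) (S2 t) p)
  (M' K omega' : R) (M'_ge1 : 1 <= M') (K_gt0 : 0 < K)
  (stable_T : forall (t : R) (n : nat), 0 <= t -> (1 <= n)%nat ->
     Rbar_le (op_norm (sym_prod_pow (T1 (t / INR n)) (T2 (t / INR n)) n))
             (M' * exp (omega' * t)))
  (stable_S : forall (t : R) (n : nat), 0 <= t -> (1 <= n)%nat ->
     Rbar_le (op_norm (sym_prod_pow (S1 (t / INR n)) (S2 (t / INR n)) n))
             (M' * exp (omega' * t)))
  (R1_bound : forall t, 0 <= t ->
     Rbar_le (op_norm (R1 t)) (K * t * exp (omega' * t)))
  (R2_bound : forall t, 0 <= t ->
     Rbar_le (op_norm (R2 t)) (K * t * exp (omega' * t)))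
  (C w : R) (HC : 0 <= C) (Hw : 0 <= w)
  (T_growth : forall t, 0 <= t -> forall x,
     norm (T1 t x) <= C * exp (w * t) * norm x /\
     norm (T2 t x) <= C * exp (w * t) * norm x)
  (S_growth : forall t, 0 <= t -> forall y,
     norm (S1 t y) <= C * exp (w * t) * norm y /\
     norm (S2 t y) <= C * exp (w * t) * norm y)
  (t : R) (n : nat) (Ht : 0 <= t) (Hn : (1 <= n)%nat) :
  Rbar_le (op_norm (sym_prod_pow (TT1 (t / INR n)) (TT2 (t / INR n)) n))
          ((2 * M' + 2 * C * K * M' ^ 2) * exp ((omega' + w + 1) * t)).
Proof.
  assert (HCK : 0 <= 2 * C * K * M' ^ 2).
  { apply Rmult_le_pos; [apply Rmult_le_pos; [apply Rmult_le_pos|]; lra | apply pow2_ge_0]. }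
  assert (Hn0 : 0 < INR n) by (apply lt_0_INR; lia).
  set (h := t / INR n).
  assert (Hh : 0 <= h) by (apply Rdiv_le_0_compat; trivial).
  assert (Hnh : INR n * h = t) by (unfold h; field; lra).
  assert (Hht : h <= t).
  { rewrite <- Hnh; rewrite <- (Rmult_1_l h) at 1; apply Rmult_le_compat_r; trivial.
    now apply (le_INR 1). }
  set (c := C * exp (w * h)).
  assert (Hc : 0 <= c) by (apply Rmult_le_pos; [lra | apply Rlt_le, exp_pos]).
  set (r := K * h * exp (omega' * h)).
  assert (Hr : 0 <= r).
  { apply Rmult_le_pos; [apply Rmult_le_pos; lra | apply Rlt_le, exp_pos]. }
  assert (rR1 : forall y, norm (R1 h y) <= r * norm y).
  { apply unit_bound_norm; [now apply R_bounded|]. now apply op_norm_le_unit, R1_bound. }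
  assert (rR2 : forall y, norm (R2 h y) <= r * norm y).
  { apply unit_bound_norm; [now apply R_bounded|]. now apply op_norm_le_unit, R2_bound. }
  set (B := corner (T1 h) (T2 h) (R1 h) (R2 h) (S1 h) (S2 h)).
  assert (HB : forall y, norm (B y) <= 4 * (c * r) * norm y).
  { apply corner_bound; trivial; intros z;
      first [apply (T_growth h Hh) | apply (S_growth h Hh)]. }
  assert (HA : is_linear (op_plus (op_mult (T1 h) (T2 h)) (op_mult (T2 h) (T1 h)))).
  { destruct (T_bounded h Hh) as [L1 L2]; apply is_linear_op_plus.
    - exact (is_linear_comp (T2 h) (T1 h) L2 L1).
    - exact (is_linear_comp (T1 h) (T2 h) L1 L2). }
  set (G := op_plus (op_mult (TT1 h) (TT2 h)) (op_mult (TT2 h) (TT1 h))).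
  assert (HG : forall p, G p =
      (plus (op_plus (op_mult (T1 h) (T2 h)) (op_mult (T2 h) (T1 h)) (fst p)) (B (snd p)),
       op_plus (op_mult (S1 h) (S2 h)) (op_mult (S2 h) (S1 h)) (snd p))).
  { intros p; destruct (T_bounded h Hh) as [L1 L2].
    unfold G, op_plus at 1, op_mult at 1 2.
    rewrite !triangular1, !triangular2 by trivial.
    now apply triangular_sym_prod. }
  set (q := exp (omega' * h)).
  assert (Hq : 0 < q) by apply exp_pos.
  destruct (op_norm_le_unit s _ _ (sym_prod_pow (TT1 h) (TT2 h) n)
    ((2 * M' + 2 * C * K * M' ^ 2) * exp ((omega' + w + 1) * t))) as [_ Hop].
  apply Hop; clear Hop.
  intros [x y] Hp.
  assert (Hx : norm x <= 1).
  { apply Rle_trans with (2 := Hp).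
    apply Rle_trans with (2 := proj1 (norm_prod x y)), Rmax_l. }
  assert (Hy : norm y <= 1).
  { apply Rle_trans with (2 := Hp).
    apply Rle_trans with (2 := proj1 (norm_prod x y)), Rmax_r. }
  unfold sym_prod_pow, op_scal; fold G.
  assert (H2n : 0 < 2 ^ n) by (apply pow_lt; lra).
  rewrite norm_scal_of_real, Rabs_pos_eq.
  2: { apply Rlt_le, Rdiv_lt_0_compat; lra. }
  destruct (upper_triangular_pow_bound s E F G _ B _ M' (4 * (c * r)) (2 * q)
    HA HG) with (k := n) (p := (x, y)) as [H1 H2]; try lra.
  { apply Rmult_le_pos; [lra | apply Rmult_le_pos; lra]. }
  { intros; now apply stable_powers. }
  { intros; now apply stable_powers. }
  { trivial. }
  simpl fst in H1; simpl snd in H1, H2.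
  assert (Hqn : q ^ n = exp (omega' * t)).
  { unfold q; rewrite exp_pow_INR, <- Hnh; f_equal; ring. }
  set (e := exp ((omega' + w + 1) * t)).
  assert (He : 0 < e) by apply exp_pos.
  assert (Hqe : q ^ n <= e).
  { rewrite Hqn; apply exp_nondecreasing, Rmult_le_compat_r; lra. }
  (* The factor t collects the n corner terms, each of size O(h); the summand 1 in
     the growth rate pays for it. *)
  assert (Hte : t * exp (w * h) * q ^ n <= e).
  { rewrite Hqn; unfold e.
    replace ((omega' + w + 1) * t) with (t + w * t + omega' * t) by ring.
    rewrite !exp_plus; apply Rmult_le_compat_r; [apply Rlt_le, exp_pos|].
    apply Rmult_le_compat; [trivial | apply Rlt_le, exp_pos | |].
    - pose proof (exp_ineq1_le t); lra.
    - now apply exp_nondecreasing, Rmult_le_compat_l. }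
  rewrite Rpow_mult_distr in H1, H2.
  assert (Hdiagonal : forall v, 0 <= v <= 1 ->
      M' * (2 ^ n * q ^ n) * v <= 2 ^ n * (M' * e)).
  { intros v Hv; replace (2 ^ n * (M' * e)) with (M' * (2 ^ n * e) * 1) by ring.
    apply Rmult_le_compat; try lra.
    - apply Rmult_le_pos; [lra | apply Rmult_le_pos; [lra | apply pow_le; lra]].
    - apply Rmult_le_compat_l; [lra|]. apply Rmult_le_compat_l; lra. }
  assert (Hcorner : INR n * (M' ^ 2 * (4 * (c * r) / (2 * q))) * (2 ^ n * q ^ n) * norm y
      <= 2 ^ n * (2 * C * K * M' ^ 2 * e)).
  { replace (INR n * (M' ^ 2 * (4 * (c * r) / (2 * q))) * (2 ^ n * q ^ n) * norm y)
      with (2 ^ n * (2 * C * K * M' ^ 2) * (t * exp (w * h) * q ^ n) * norm y).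
    2: { unfold c, r; fold q; rewrite <- Hnh; field; lra. }
    replace (2 ^ n * (2 * C * K * M' ^ 2 * e))
      with (2 ^ n * (2 * C * K * M' ^ 2) * e * 1) by ring.
    assert (Hfac : 0 <= 2 ^ n * (2 * C * K * M' ^ 2)) by (apply Rmult_le_pos; lra).
    apply Rmult_le_compat; [| apply norm_ge_0 | | trivial].
    - apply Rmult_le_pos; [trivial|].
      apply Rmult_le_pos; [|apply pow_le; lra].
      apply Rmult_le_pos; [trivial | apply Rlt_le, exp_pos].
    - now apply Rmult_le_compat_l. }
  pose proof (Hdiagonal (norm x) (conj (norm_ge_0 x) Hx)).
  pose proof (Hdiagonal (norm y) (conj (norm_ge_0 y) Hy)).
  assert (Hsum : norm (op_pow G n (x, y))
      <= norm (fst (op_pow G n (x, y))) + norm (snd (op_pow G n (x, y)))).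
  { destruct (op_pow G n (x, y)) as [u v]; apply prod_norm_le_sum. }
  set (N := norm (op_pow G n (x, y))) in *.
  apply Rmult_le_reg_l with (1 := H2n).
  replace (2 ^ n * (1 / 2 ^ n * N)) with N by (field; lra).
  lra.
Qed.

(** * The stability theorem *)

Theorem theorem2p3
  (s : scalars) (E F : CompleteNormedModule (scalar_ring s))
  (A1 A2 : unbounded_operator (prod_NormedModule (scalar_ring s) E F))
  (TT1 TT2 : R -> prod_NormedModule (scalar_ring s) E F ->
                  prod_NormedModule (scalar_ring s) E F)
  (T1 T2 : R -> E -> E) (R1 R2 : R -> F -> E) (S1 S2 : R -> F -> F)
  (gen1 : generates A1 TT1) (gen2 : generates A2 TT2)
  (T_bounded : forall t, 0 <= t -> is_linear (T1 t) /\ is_linear (T2 t))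
  (R_bounded : forall t, 0 <= t -> is_linear (R1 t) /\ is_linear (R2 t))
  (S_bounded : forall t, 0 <= t -> is_linear (S1 t) /\ is_linear (S2 t))
  (triangular1 : forall t, 0 <= t -> forall p,
     TT1 t p = op_matrix (T1 t) (R1 t) (op_zero E F) (S1 t) p)
  (triangular2 : forall t, 0 <= t -> forall p,
     TT2 t p = op_matrix (T2 t) (R2 t) (op_zero E F) (S2 t) p)
  (M' K omega' : R) (M'_ge1 : 1 <= M') (K_gt0 : 0 < K)
  (stable_T : forall (t : R) (n : nat), 0 <= t -> (1 <= n)%nat ->
     Rbar_le (op_norm (sym_prod_pow (T1 (t / INR n)) (T2 (t / INR n)) n))
             (M' * exp (omega' * t)))
  (stable_S : forall (t : R) (n : nat), 0 <= t -> (1 <= n)%nat ->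
     Rbar_le (op_norm (sym_prod_pow (S1 (t / INR n)) (S2 (t / INR n)) n))
             (M' * exp (omega' * t)))
  (R1_bound : forall t, 0 <= t ->
     Rbar_le (op_norm (R1 t)) (K * t * exp (omega' * t)))
  (R2_bound : forall t, 0 <= t ->
     Rbar_le (op_norm (R2 t)) (K * t * exp (omega' * t))) :
  exists M omega : R, 1 <= M /\
    forall (t : R) (n : nat), 0 <= t -> (1 <= n)%nat ->
      Rbar_le (op_norm (sym_prod_pow (TT1 (t / INR n)) (TT2 (t / INR n)) n))
              (M * exp (omega * t)).
Proof.
  destruct (diagonal_blocks_C0_semigroup s E F TT1 T1 R1 S1) as [HT1 HS1];
    [apply gen1 | intros; now apply T_bounded | intros; now apply R_bounded
    | intros; now apply S_bounded | trivial |].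
  destruct (diagonal_blocks_C0_semigroup s E F TT2 T2 R2 S2) as [HT2 HS2];
    [apply gen2 | intros; now apply T_bounded | intros; now apply R_bounded
    | intros; now apply S_bounded | trivial |].
  destruct (C0_semigroup_exp_bounded s E T1 HT1) as (C1 & w1 & HC1 & Hw1 & BT1).
  destruct (C0_semigroup_exp_bounded s E T2 HT2) as (C2 & w2 & HC2 & Hw2 & BT2).
  destruct (C0_semigroup_exp_bounded s F S1 HS1) as (C3 & w3 & HC3 & Hw3 & BS1).
  destruct (C0_semigroup_exp_bounded s F S2 HS2) as (C4 & w4 & HC4 & Hw4 & BS2).
  (* Sums serve as common upper bounds, all the constants being nonnegative. *)
  set (C := C1 + C2 + C3 + C4); set (w := w1 + w2 + w3 + w4).
  assert (HC : 0 <= C) by (unfold C; lra).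
  assert (Hw : 0 <= w) by (unfold w; lra).
  exists (2 * M' + 2 * C * K * M' ^ 2), (omega' + w + 1).
  split.
  { assert (0 <= 2 * C * K * M' ^ 2); [|lra].
    apply Rmult_le_pos; [apply Rmult_le_pos; lra | apply pow2_ge_0]. }
  assert (Hweaken : forall (L : NormedModule (scalar_ring s)) (x y : L) Ci wi t,
      norm y <= Ci * exp (wi * t) * norm x ->
      0 <= Ci <= C -> wi <= w -> 0 <= t -> norm y <= C * exp (w * t) * norm x).
  { intros L x y Ci wi t Hy HCi Hwi Ht; apply Rle_trans with (1 := Hy).
    apply Rmult_le_compat_r; [apply norm_ge_0 | now apply common_exp_bound]. }
  apply (triangular_sym_prod_stable s E F TT1 TT2 T1 T2 R1 R2 S1 S2); trivial.
  - intros t Ht x; split;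
      [apply Hweaken with (1 := BT1 t Ht x) | apply Hweaken with (1 := BT2 t Ht x)];
      unfold C, w; lra.
  - intros t Ht x; split;
      [apply Hweaken with (1 := BS1 t Ht x) | apply Hweaken with (1 := BS2 t Ht x)];
      unfold C, w; lra.
Qed.
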